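(* Let $n \geq 3$ and let $p(z)=\sum_{i=0}^{n} a_i z^i \in \mathbb{C}[z]$ be a complex polynomial of degree $n$ which is monic ($a_n=1$). Let $\mu(p) := \max\{|\lambda| : \lambda\in\mathbb{C},\ p(\lambda)=0\}$ be its largest root-modulus. Put $$\tau := \max\left\{ \sqrt[3]{|a_{n-3}|/2.15},\ \sqrt[4]{|a_{n-4}|/2},\ \sqrt[5]{|a_{n-5}|},\ \sqrt[6]{|a_{n-6}|},\ \ldots,\ \sqrt[n]{|a_{0}|}\right\},$$ that is, $\tau=\max_{3\le k\le n} \sqrt[k]{|a_{n-k}|/w_k}$ with $w_3=2.15$, $w_4=2$ and $w_k=1$ for $k\ge 5$. Define $$\Gamma(p) := \max\left\{ \sqrt{3.15}\,\sqrt{\tau^2+\max\{|a_{n-2}|,\,2\tau^2\}}\,,\ \ \frac{|a_{n-1}|+\sqrt{|a_{n-1}|^2+4\left(\tau^2+\max\{|a_{n-2}|,\,2.15\,\tau^2\}\right)}}{2}\right\}.$$ Then $\mu(p)\leq \Gamma(p)$.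
   Context: All roots are taken in the exponent-$k$ nonnegative real sense. The decimals $2.15$ and $3.15$ denote the exact rational numbers $215/100$ and $315/100$. *)

(* Defs.v *)
From mathcomp Require Import all_boot all_order all_algebra.
From mathcomp Require Import boolp classical_sets reals exp.
From mathcomp Require Import complex.

Set Implicit Arguments.
Unset Strict Implicit.
Unset Printing Implicit Defensive.

Import Order.TTheory GRing.Theory Num.Theory.

Local Open Scope ring_scope.
Local Open Scope complex_scope.
Local Open Scope classical_set_scope.

(* The modulus as an element of R; the generic norm `|z| takes its values in
   R[i]. *)
Definition cabs (R : realType) (z : R[i]) : R := ComplexField.Normc.normc z.

(* For k > 0 and 0 <= x, the k-th root of x in the nonnegative reals. *)
Definition kroot (R : realType) (k : nat) (x : R) : R := x `^ k%:R^-1.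

Lemma kroot_ge0 (R : realType) (k : nat) (x : R) : 0 <= kroot k x.
Proof. exact: powR_ge0. Qed.

Lemma krootK (R : realType) (k : nat) (x : R) :
  (0 < k)%N -> 0 <= x -> kroot k x ^+ k = x.
Proof.
move=> k0 x0; rewrite /kroot -powR_mulrn ?powR_ge0// -powRrM mulVf ?powRr1//.
by rewrite pnatr_eq0 -lt0n.
Qed.

(* When p is not constant, the supremum is a maximum: see [muP]. *)
Definition mu (R : realType) (p : {poly R[i]}) : R :=
  sup [set cabs z | z in [set z | root p z]].

Lemma muP (R : realType) (p : {poly R[i]}) : (1 < size p)%N ->
  (exists2 z, root p z & cabs z = mu p) /\
  (forall z, root p z -> cabs z <= mu p).
Proof.
move=> p1.
suff [z pz zmax] : exists2 z, root p z & forall y, root p y -> cabs y <= cabs z.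
  have -> : mu p = cabs z.
    apply/eqP; rewrite eq_le; apply/andP; split.
      by apply: ge_sup => [|_ [y py <-]]; [exists (cabs z), z|exact: zmax].
    apply: ub_le_sup; last by exists z.
    by exists (cabs z) => _ [y py <-]; exact: zmax.
  by split => //; exists z.
have p0 : p != 0 by rewrite -size_poly_gt0 ltnW.
have [r pE] := closed_field_poly_normal p.
have rootE z : root p z = (z \in r).
  by rewrite pE rootZ ?lead_coef_eq0// root_prod_XsubC.
have rN0 : r != [::].
  apply: contraTneq p1 => r0; rewrite pE r0 big_nil size_scale ?lead_coef_eq0//.
  by rewrite size_poly1.
suff [z zr zmax] : exists2 z, z \in r & forall y, y \in r -> cabs y <= cabs z.
  by exists z => [|y]; rewrite rootE//; exact: zmax.
elim: r rN0 {pE rootE} => // x [|x' r] IH _.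
  by exists x; [rewrite mem_head|move=> y /[!inE]/eqP->].
have [//|z zr zmax] := IH.
have [xz|/ltW zx] := leP (cabs x) (cabs z).
  by exists z => [|y]; rewrite inE ?zr ?orbT// => /predU1P[->//|]; exact: zmax.
exists x => [|y]; first exact: mem_head.
by rewrite inE => /predU1P[->//|/zmax/le_trans]; exact.
Qed.

Definition weight (R : realType) (k : nat) : R :=
  if (k == 3)%N then 215 / 100 else if (k == 4)%N then 2 else 1.

(* All the k-th roots here are nonnegative, so the default value 0 does not affect the
   maximum when 3 <= n. *)
Definition tau (R : realType) (n : nat) (p : {poly R[i]}) : R :=
  \big[Num.max/0]_(3 <= k < n.+1) kroot k (cabs p`_(n - k) / weight R k).

Definition Gamma (R : realType) (n : nat) (p : {poly R[i]}) : R :=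
  let t := tau n p in
  let a1 := cabs p`_(n - 1) in
  let a2 := cabs p`_(n - 2) in
  Num.max
    (Num.sqrt (315 / 100) * Num.sqrt (t ^+ 2 + Num.max a2 (2 * t ^+ 2)))
    ((a1 + Num.sqrt (a1 ^+ 2
                     + 4 * (t ^+ 2 + Num.max a2 (215 / 100 * t ^+ 2)))) / 2).

(* Main.v *)
Require Import Defs.
From mathcomp Require Import all_boot all_order all_algebra.
From mathcomp Require Import reals complex.
From mathcomp Require Import unstable lra.

Import Order.TTheory GRing.Theory Num.Theory.

Local Open Scope ring_scope.
Local Open Scope complex_scope.

(** Let [z] be a root of [p], [x] its modulus, [t := tau n p], and let [a1],
    [a2] be the moduli of the coefficients of degrees [n - 1] and [n - 2].
    By the definition of [tau], the coefficient of degree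
    [n - k] has modulus at most [weight k * t ^+ k] for every [k >= 3], so the
    triangle inequality in [p.[z] = 0] gives
      [x ^+ n <= a1 * x ^+ n.-1 + a2 * x ^+ (n - 2) + T],
    where [T] is the sum of the [weight k * t ^+ k * x ^+ (n - k)], [k >= 3]
    ([root_modulus_le]).

    The threshold [x = 3 * t] separates two regimes.  When [x <= 3 * t], the
    first term of [Gamma] is already large enough, because
    [315 / 100 * (t ^+ 2 + 2 * t ^+ 2) >= (3 * t) ^+ 2].  When [3 * t <= x],
    the tail [T] is dominated by a geometric series of ratio [1 / 3]; relative
    to [t ^+ 2 * x ^+ (n - 2)] it is at most
      [2.15 / 3 + 2 / 9 + (1 / 27 + 1 / 81 + ...) = 0.99444... < 1]
    ([weighted_tail_le]).  Dividing by [x ^+ (n - 2)] leaves the quadratic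
    inequality [x ^+ 2 <= a1 * x + (a2 + t ^+ 2)], and [x] is then at most the
    larger root of that quadratic, which the second term of [Gamma] bounds. *)

Lemma cabs_ge0 (R : realType) (z : R[i]) : 0 <= cabs z.
Proof. by case: z => a b; rewrite /cabs /= sqrtr_ge0. Qed.

Lemma cabsX (R : realType) (z : R[i]) (k : nat) : cabs (z ^+ k) = cabs z ^+ k.
Proof.
elim: k => [|k IH]; first by rewrite !expr0; exact: ComplexField.Normc.normc1.
by rewrite !exprS -IH; exact: ComplexField.Normc.normcM.
Qed.

Lemma cabs_sum_le (R : realType) (I : Type) (r : seq I) (F : I -> R[i]) :
  cabs (\sum_(i <- r) F i) <= \sum_(i <- r) cabs (F i).
Proof.
elim: r => [|i r IH].
  by rewrite !big_nil /cabs ComplexField.Normc.normc0.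
rewrite !big_cons; apply: le_trans (lerD (lexx _) IH).
exact: le_normcD.
Qed.

Lemma weight_gt0 (R : realType) (k : nat) : 0 < weight R k.
Proof. by rewrite /weight; case: ifP => _; [lra | case: ifP => _; lra]. Qed.

Lemma tau_ge0 (R : realType) (n : nat) (p : {poly R[i]}) : 0 <= tau n p.
Proof.
rewrite /tau; elim/big_rec: _ => // k y _ y0.
by rewrite le_max y0 orbT.
Qed.

Lemma coef_le_tau (R : realType) (n k : nat) (p : {poly R[i]}) :
  (3 <= k <= n)%N -> cabs p`_(n - k) <= weight R k * tau n p ^+ k.
Proof.
move=> /andP[k3 kn]; rewrite mulrC -ler_pdivrMr ?weight_gt0//.
have c0 : 0 <= cabs p`_(n - k) / weight R k.
  by rewrite divr_ge0 ?cabs_ge0 ?(ltW (weight_gt0 _ _)).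
have k0 : (0 < k)%N by exact: leq_trans k3.
rewrite -[leLHS](krootK k0 c0); apply: lerXn2r.
- by rewrite nnegrE kroot_ge0.
- by rewrite nnegrE tau_ge0.
by apply: (le_bigmax_seq 0 k xpredT) => //; rewrite mem_index_iota k3 ltnS.
Qed.

(** The summand [t ^+ n / 2] is the room that makes the induction work: passing
    from [n] to [n + 1] with weight [1] adds [t ^+ n.+1] to the tail, and
    [t ^+ n.+1 + t ^+ n.+1 / 2] is at most [x * (t ^+ n / 2)] as [3 * t <= x].
    The factor [1 / 2] is the sum of the remaining geometric series of ratio
    [1 / 3]. *)
Lemma weighted_tail_le (R : realType) (t x : R) (n : nat) :
  0 <= t -> 3 * t <= x -> (3 <= n)%N ->
  \sum_(3 <= k < n.+1) weight R k * t ^+ k * x ^+ (n - k) + t ^+ n / 2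
    <= t ^+ 2 * x ^+ (n - 2).
Proof.
move=> t0 tx; have x0 : 0 <= x by lra.
have step m : (2 <= m)%N ->
    \sum_(3 <= k < m.+2) weight R k * t ^+ k * x ^+ (m.+1 - k) =
    x * \sum_(3 <= k < m.+1) weight R k * t ^+ k * x ^+ (m - k)
    + weight R m.+1 * t ^+ m.+1.
  move=> m2; rewrite big_nat_recr//= subnn expr0 mulr1 big_distrr /=.
  congr (_ + _); rewrite !big_nat; apply: eq_bigr => k /andP[_ km].
  by rewrite subSn// exprS mulrCA.
elim: n => // -[//|[//|[_ _|n IH _]]].
  rewrite step// big_geq// /weight/= mulr0 add0r expr1.
  have -> : t ^+ 3 = t ^+ 2 * t by rewrite exprSr.
  suff : 0 <= t ^+ 2 * (x - (215 / 100 + 1 / 2) * t) by lra.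
  by rewrite mulr_ge0 ?exprn_ge0//; lra.
rewrite step//; case: n IH => [_|n /(_ isT) IH].
  (* The weight 2 at k = 4 is too large for the induction step, so n = 4 is
     computed directly: it holds as 215 / 100 * 3 + 5 / 2 <= 3 ^+ 2. *)
  rewrite step// big_geq// /weight/= mulr0 add0r.
  have -> : t ^+ 3 = t ^+ 2 * t by rewrite exprSr.
  have -> : t ^+ 4 = t ^+ 2 * t ^+ 2 by rewrite -exprD.
  suff : 0 <= t ^+ 2 * (x ^+ 2 - 215 / 100 * (t * x) - 5 / 2 * t ^+ 2) by lra.
  by rewrite mulr_ge0 ?exprn_ge0//; nra.
have tn : 0 <= t ^+ n.+4 by rewrite exprn_ge0.
rewrite /weight/= mul1r subSn// [in leRHS]exprS mulrCA.
apply: le_trans (ler_wpM2l x0 IH); rewrite mulrDr -addrA lerD2l.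
by rewrite exprS; nra.
Qed.

Lemma root_modulus_le (R : realType) (n : nat) (p : {poly R[i]}) (z : R[i]) :
  (3 <= n)%N -> size p = n.+1 -> p \is monic -> root p z ->
  cabs z ^+ n <= cabs p`_(n - 1) * cabs z ^+ (n - 1)
    + cabs p`_(n - 2) * cabs z ^+ (n - 2)
    + \sum_(3 <= k < n.+1) weight R k * tau n p ^+ k * cabs z ^+ (n - k).
Proof.
move=> n3 sp mp /rootP.
rewrite horner_coef sp -(big_mkord xpredT (fun i => p`_i * z ^+ i)) big_nat_rev.
rewrite big_ltn//= add0n subSS subn0.
have -> : p`_n = 1 by move: mp; rewrite monicE lead_coefE sp => /eqP.
rewrite mul1r => /eqP; rewrite addr_eq0 => /eqP zn.
rewrite -cabsX zn /cabs normcN -/(cabs _).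
apply: le_trans (cabs_sum_le _ _ _ _) _.
have cM i : cabs (p`_i * z ^+ i) = cabs p`_i * cabs z ^+ i.
  by rewrite -cabsX; exact: ComplexField.Normc.normcM.
have n1 : (1 < n.+1)%N by rewrite ltnS (leq_trans _ n3).
have n2 : (2 < n.+1)%N by rewrite ltnS (leq_trans _ n3).
rewrite (big_ltn n1) (big_ltn n2) !subSS !cM addrA.
rewrite lerD2l big_nat [leRHS]big_nat; apply: ler_sum => k /andP[k3 kn].
rewrite subSS cM ler_wpM2r ?exprn_ge0 ?cabs_ge0//.
by apply: coef_le_tau; rewrite k3.
Qed.

Lemma le_quadratic_root (R : rcfType) (a b x : R) :
  x ^+ 2 <= a * x + b -> x <= (a + Num.sqrt (a ^+ 2 + 4 * b)) / 2.
Proof.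
move=> xab; have sq : (2 * x - a) ^+ 2 <= a ^+ 2 + 4 * b by lra.
suff : 2 * x - a <= Num.sqrt (a ^+ 2 + 4 * b) by lra.
by apply: le_trans (ler_norm _) _; rewrite -sqrtr_sqr ler_wsqrtr.
Qed.

Theorem proposition2p1 (R : realType) (n : nat) (p : {poly R[i]})
  (n_ge3 : (3 <= n)%N) (deg_p : size p = n.+1) (monic_p : p \is monic) :
  mu p <= Gamma n p.
Proof.
have [[z pz <-] _] : (exists2 z, root p z & cabs z = mu p) /\
    (forall z, root p z -> cabs z <= mu p).
  by apply: muP; rewrite deg_p ltnS ltnW// ltnW.
have xineq := root_modulus_le _ _ _ _ n_ge3 deg_p monic_p pz.
move: (cabs_ge0 _ z) (tau_ge0 _ n p) xineq.
rewrite /Gamma; move: (cabs z) (tau n p) => x t x0 t0.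
move: (cabs p`_(n - 1)) (cabs p`_(n - 2)) => a1 a2 xineq.
rewrite le_max; have [xt|tx] := leP x (3 * t).
  apply/orP; left; apply: le_trans xt _.
  rewrite -sqrtrM; last by lra.
  have t3 : 0 <= 3 * t by lra.
  rewrite -[leLHS](ger0_norm t3) -sqrtr_sqr; apply: ler_wsqrtr.
  set M := Num.max _ _.
  have tM : 2 * t ^+ 2 <= M by rewrite le_max lexx orbT.
  by have t2 := sqr_ge0 t; lra.
apply/orP; right; apply: le_quadratic_root.
have xgt0 : 0 < x by lra.
suff le2 : x ^+ 2 <= a1 * x + (a2 + t ^+ 2).
  by apply: le_trans le2 _; rewrite lerD2l addrC lerD2l le_max lexx.
rewrite -(ler_pM2r (exprn_gt0 (n - 2) xgt0)) -exprD subnKC; last exact: ltnW.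
apply: le_trans xineq _; rewrite mulrDl mulrDl -mulrA -exprS.
have -> : (n - 1 = (n - 2).+1)%N by rewrite -subSn 1?ltnW.
rewrite -addrA !lerD2l.
apply: le_trans (weighted_tail_le _ _ _ _ t0 (ltW tx) n_ge3).
by rewrite lerDl divr_ge0 ?exprn_ge0.
Qed.
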